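(* Let $A_n$ be a self-adjoint operator in a Hilbert space $\mathcal H_n$ for each $n\in\overline{\mathbb N}$. Suppose that $(A_n)_{n\in\mathbb N}$ QUE-converges to $A_\infty$ at $z_0$ with identification operators $(J_n)_{n\in\mathbb N}$ and convergence speed $(\delta_n)_n$, and that a parent space with isometries factorising $(J_n)_{n\in\mathbb N}$ exists. Then $(A_n)_{n\in\mathbb N}$ Weidmann-converges to $A_\infty$ at $z_0$ with convergence speed $$\widetilde\delta_n:=\delta_n^{1/2}\cdot\Bigl(2\bigl(\|R_\infty\|_{\mathcal L(\mathcal H_\infty)}+2\delta_n\bigr)^{1/2}+\delta_n^{1/2}\Bigr)\in\mathrm O(\delta_n^{1/2}),$$ where $R_\infty=(A_\infty-z_0)^{-1}$.
   Context: All Hilbert spaces are complex and separable; $\mathbb N=\{1,2,\dots\}$, $\overline{\mathbb N}=\mathbb N\cup\{\infty\}$; $\mathcal L(\mathcal H)$ denotes bounded operators on $\mathcal H$; norms of operators are operator norms; $\rho(A)$ is the resolvent set. For $z_0\in\bigcap_{n\in\overline{\mathbb N}}\rho(A_n)$ write $R_n:=(A_n-z_0)^{-1}$, $n\in\overline{\mathbb N}$. Let $(\delta_n)_{n\in\mathbb N}$ be a sequence in $[0,\infty)$ with $\delta_n\to0$. $(A_n)_{n\in\mathbb N}$ Weidmann-converges to $A_\infty$ at $z_0$ with convergence speed $(\delta_n)_n$ if there exist a Hilbert space $\mathcal H$ and isometries $\iota_n:\mathcal H_n\to\mathcal H$ ($n\in\overline{\mathbb N}$) such that $\|\iota_nR_n\iota_n^*-\iota_\infty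 R_\infty\iota_\infty^*\|\le\delta_n$ for all $n\in\mathbb N$. $(A_n)_{n\in\mathbb N}$ QUE-converges to $A_\infty$ at $z_0$ with identification operators $(J_n)_n$ and convergence speed $(\delta_n)_n$ if $J_n:\mathcal H_n\to\mathcal H_\infty$ ($n\in\mathbb N$) are bounded operators such that for all $n\in\mathbb N$: (i) $\|J_n\|\le1+\delta_n$; (ii) $\|(\mathrm{id}_{\mathcal H_n}-J_n^*J_n)R_n\|\le\delta_n$ and $\|(\mathrm{id}_{\mathcal H_\infty}-J_nJ_n^* )R_\infty\|\le\delta_n$; (iii) $\|R_\infty J_n-J_nR_n\|\le\delta_n$; and, if $z_0\in\mathbb C\setminus\mathbb R$, (ii) and (iii) also hold with $R_n,R_\infty$ replaced by $R_n^*,R_\infty^*$. A parent space for $(\mathcal H_n)_{n\in\overline{\mathbb N}}$ is a Hilbert space $\mathcal H$ together with isometries $\iota_n:\mathcal H_n\to\mathcal H$ for all $n\in\overline{\mathbb N}$; these isometries factorise $(J_n)_{n\in\mathbb N}$ if $J_n=\iota_\infty^*\iota_n$ for all $n\in\mathbb N$. *)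

(* Defs.v *)
From HB Require Import structures.
From mathcomp Require Import all_boot all_order all_algebra.
From mathcomp Require Import all_classical all_reals all_analysis.
From mathcomp Require Import complex.

Set Implicit Arguments.
Unset Strict Implicit.
Unset Printing Implicit Defensive.

Import Order.TTheory GRing.Theory Num.Theory.
Import numFieldNormedType.Exports.

Local Open Scope classical_set_scope.
Local Open Scope ring_scope.
Local Open Scope complex_scope.

(* The inner product is linear in its first argument and conjugate-linear in
   its second one. Norms are elements of R[i] (nonnegative reals), as always
   for a normed module over R[i]. *)
HB.mixin Record CompleteNormedModule_isHilbert (R : realType) H
    of CompleteNormedModule R[i] H := {
  hdot : {dot H for (@Num.conj R[i])} ;
  hdotxx : forall x : H, hdot x x = `|x| ^+ 2 ;
  hilbert_separable : exists D : set H, countable D /\ dense D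
}.

#[short(type="hilbertType")]
HB.structure Definition Hilbert (R : realType) :=
  {H of CompleteNormedModule R[i] H & CompleteNormedModule_isHilbert R H}.

Arguments hdot {R s}.

Section bounded_operators.
Variable R : realType.
Implicit Types U V : hilbertType R.

Definition opnorm U V (f : U -> V) : \bar R :=
  ereal_sup [set (complex.Re `|f x|)%:E | x in [set x : U | `|x| <= 1]].

Definition bounded_op U V (f : {linear U -> V}) : Prop := (opnorm f < +oo)%E.

(* For a bounded linear f, the Riesz theorem provides the vector selected
   here, which is unique. *)
Definition adjoint U V (f : U -> V) (y : V) : U :=
  xget 0 [set z : U | forall x : U, hdot (f x) y = hdot x z].

Definition is_isometry U V (f : {linear U -> V}) : Prop :=
  forall x : U, `|f x| = `|x|.

End bounded_operators.

Arguments opnorm {R U V} f%_ring_scope.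

(* The values of op_fun outside op_dom are irrelevant. *)
Record unbounded_operator (R : realType) (H : hilbertType R) := UnboundedOp {
  op_dom : set H ;
  op_fun :> H -> H ;
  op_dom0 : op_dom 0 ;
  op_dom_linear : forall (a : R[i]) (x y : H),
    op_dom x -> op_dom y -> op_dom (a *: x + y) ;
  op_fun_linear : forall (a : R[i]) (x y : H),
    op_dom x -> op_dom y -> op_fun (a *: x + y) = a *: op_fun x + op_fun y
}.

Section unbounded_operators.
Variables (R : realType) (H : hilbertType R).
Implicit Types (A : unbounded_operator H) (z : R[i]).

Definition op_graph A : set (H * H) :=
  [set p | op_dom A p.1 /\ A p.1 = p.2].

(* The graph of the adjoint of A when A is densely defined. *)
Definition adjoint_graph A : set (H * H) :=
  [set p | forall x, op_dom A x -> hdot (A x) p.1 = hdot x p.2].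

Definition self_adjoint A : Prop :=
  dense (op_dom A) /\ adjoint_graph A = op_graph A.

(* The inverse of [A - z : dom A -> H] when the latter is bijective. *)
Definition resolvent A z (y : H) : H :=
  xget 0 [set x | op_dom A x /\ A x - z *: x = y].

Definition resolvent_set A : set R[i] :=
  [set z | set_bij (op_dom A) [set: H] (fun x => A x - z *: x) /\
           (opnorm (resolvent A z) < +oo)%E].

End unbounded_operators.

(* Sequences are indexed by nat, starting at 0; the limit object is a
   separate argument. *)

Definition convergence_speed (R : realType) (delta : R^nat) : Prop :=
  (forall n, 0 <= delta n) /\ delta n @[n --> \oo] --> (0 : R).

Record parent_space (R : realType) (H : nat -> hilbertType R)
    (Hoo : hilbertType R) := ParentSpace {
  ps_space :> hilbertType R ;
  ps_iota : forall n, {linear H n -> ps_space} ;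
  ps_iotaoo : {linear Hoo -> ps_space} ;
  ps_iota_isometry : forall n, is_isometry (ps_iota n) ;
  ps_iotaoo_isometry : is_isometry ps_iotaoo
}.

Section convergence.
Variables (R : realType) (H : nat -> hilbertType R) (Hoo : hilbertType R).
Implicit Types (A : forall n, unbounded_operator (H n))
  (Aoo : unbounded_operator Hoo) (z : R[i]) (delta : R^nat)
  (J : forall n, {linear H n -> Hoo}).

Definition factorises (P : parent_space H Hoo) J : Prop :=
  forall n, J n = adjoint (ps_iotaoo P) \o ps_iota P n :> (H n -> Hoo).

Definition weidmann_converges A Aoo z delta : Prop :=
  [/\ convergence_speed delta,
      (forall n, resolvent_set (A n) z),
      resolvent_set Aoo z &
      exists P : parent_space H Hoo, forall n,
        (opnorm ((ps_iota P n \o resolvent (A n) z \o adjoint (ps_iota P n))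
           \- (ps_iotaoo P \o resolvent Aoo z \o adjoint (ps_iotaoo P)))
         <= (delta n)%:E)%E].

Definition que_bounds (U V : hilbertType R) (J : U -> V) (S : U -> U)
    (T : V -> V) (d : R) : Prop :=
  [/\ (opnorm ((idfun \- (adjoint J \o J))%R \o S) <= d%:E)%E,
      (opnorm ((idfun \- (J \o adjoint J))%R \o T) <= d%:E)%E &
      (opnorm ((T \o J) \- (J \o S)) <= d%:E)%E].

Definition que_converges A Aoo z J delta : Prop :=
  [/\ convergence_speed delta,
      (forall n, resolvent_set (A n) z),
      resolvent_set Aoo z &
      forall n,
        [/\ bounded_op (J n),
            (opnorm (J n) <= (1 + delta n)%:E)%E,
            que_bounds (J n) (resolvent (A n) z) (resolvent Aoo z) (delta n) &
            z \isn't Num.real ->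
            que_bounds (J n) (adjoint (resolvent (A n) z))
              (adjoint (resolvent Aoo z)) (delta n)]].

End convergence.

(* Main.v *)
(* Let i = iota_n, j = iota_oo be the isometries of the parent space, J = j^* i,
   S and T the resolvents of A_n and A_oo. Then
     i S i^* - j T j^*
       = (1 - jj^* ) i S i^* - j (T J - J S) i^* - j T j^* (1 - ii^* ).
   The middle term has norm at most delta. The square of the norm of
   (1 - jj^* ) i S x is |S x|^2 - |J S x|^2 = Re <(1 - J^* J) S x, S x>, hence at
   most delta |S| |x|^2; the third term is handled in the same way after passing
   to its adjoint, where T^* = T if z0 is real. Finally
   |S| <= |(1 - J^* J) S| + |J S - T J| + |T J| <= |T| + 2 delta. *)
Require Import Defs.
From HB Require Import structures.
From mathcomp Require Import all_boot all_order all_algebra.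
From mathcomp Require Import all_classical all_reals all_analysis.
From mathcomp Require Import complex.
From mathcomp Require Import ring lra.

Set Implicit Arguments.
Unset Strict Implicit.
Unset Printing Implicit Defensive.

Import Order.TTheory GRing.Theory Num.Theory.
Import numFieldNormedType.Exports.

Local Open Scope classical_set_scope.
Local Open Scope ring_scope.
Local Open Scope complex_scope.

(** * Real parts of complex scalars *)

Section real_parts.
Variable R : realType.

Lemma ReD (a b : R[i]) : complex.Re (a + b) = complex.Re a + complex.Re b.
Proof. by case: a; case: b. Qed.

Lemma ReN (a : R[i]) : complex.Re (- a) = - complex.Re a.
Proof. by case: a. Qed.

Lemma ReZ (t : R) (a : R[i]) : complex.Re (t%:C * a) = t * complex.Re a.
Proof. by case: a => a b /=; rewrite mul0r subr0. Qed.

Lemma ReJ (a : R[i]) : complex.Re (Num.conj a) = complex.Re a.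
Proof. by case: a. Qed.

Lemma ge0_ReK (a : R[i]) : 0 <= a -> (complex.Re a)%:C = a.
Proof. by move=> /ger0_real; exact: RRe_real. Qed.

End real_parts.

(** * Hilbert spaces through the real-valued norm and the real part of the inner product *)

Section real_inner_product.
Variables (R : realType) (U : hilbertType R).
Implicit Types (x y z : U) (t : R).

(** Norms take values in [R[i]]; a real-valued version makes ordered arithmetic in [R] available. *)
Definition hnorm x : R := complex.Re `|x|.

Definition rdot x y : R := complex.Re (hdot x y).

Lemma hnormK x : (hnorm x)%:C = `|x|.
Proof. exact: ge0_ReK. Qed.

Lemma hnorm_ge0 x : 0 <= hnorm x.
Proof. by rewrite -lecR hnormK; exact: normr_ge0. Qed.

Lemma hnorm_eq0 x : hnorm x = 0 -> x = 0.
Proof. by move=> x0; apply/eqP; rewrite -normr_eq0 -hnormK x0. Qed.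

Lemma ler_hnormD x y : hnorm (x + y) <= hnorm x + hnorm y.
Proof. by rewrite -lecR rmorphD /= !hnormK ler_normD. Qed.

Lemma hnormZ (a : R[i]) x : hnorm (a *: x) = complex.Re `|a| * hnorm x.
Proof.
by rewrite /hnorm normrZ -(ge0_ReK (normr_ge0 a)) ReZ.
Qed.

Lemma hnormN x : hnorm (- x) = hnorm x.
Proof. by rewrite /hnorm normrN. Qed.

Lemma rdotDl x y z : rdot (x + y) z = rdot x z + rdot y z.
Proof. by rewrite /rdot linearDl ReD. Qed.

Lemma rdotNl x y : rdot (- x) y = - rdot x y.
Proof. by rewrite /rdot linearNl ReN. Qed.

Lemma rdotBl x y z : rdot (x - y) z = rdot x z - rdot y z.
Proof. by rewrite rdotDl rdotNl. Qed.

Lemma rdotZl t x y : rdot (t%:C *: x) y = t * rdot x y.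
Proof. by rewrite /rdot linearZl_LR ReZ. Qed.

Lemma hdotC x y : hdot x y = Num.conj (hdot y x).
Proof. by rewrite hermC mul1r. Qed.

Lemma rdotC x y : rdot x y = rdot y x.
Proof. by rewrite /rdot hdotC ReJ. Qed.

Lemma rdotDr x y z : rdot x (y + z) = rdot x y + rdot x z.
Proof. by rewrite rdotC rdotDl !(rdotC x). Qed.

Lemma rdotBr x y z : rdot x (y - z) = rdot x y - rdot x z.
Proof. by rewrite rdotC rdotBl !(rdotC x). Qed.

Lemma rdotZr t x y : rdot x (t%:C *: y) = t * rdot x y.
Proof. by rewrite rdotC rdotZl rdotC. Qed.

Lemma rdotxx x : rdot x x = hnorm x ^+ 2.
Proof.
by rewrite /rdot hdotxx -hnormK -rmorphXn.
Qed.

Lemma hnormD_sqr x y :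
  hnorm (x + y) ^+ 2 = hnorm x ^+ 2 + 2 * rdot x y + hnorm y ^+ 2.
Proof.
by rewrite -!rdotxx rdotDl !rdotDr (rdotC y x); ring.
Qed.

Lemma hnormB_sqr x y :
  hnorm (x - y) ^+ 2 = hnorm x ^+ 2 - 2 * rdot x y + hnorm y ^+ 2.
Proof.
by rewrite -!rdotxx rdotBl !rdotBr (rdotC y x); ring.
Qed.

Lemma hnormZ_sqr t x : hnorm (t%:C *: x) ^+ 2 = t ^+ 2 * hnorm x ^+ 2.
Proof. by rewrite -!rdotxx rdotZl rdotZr; ring. Qed.

Lemma rdot_le x y : rdot x y <= hnorm x * hnorm y.
Proof.
have [x0|x0] := eqVneq (hnorm x) 0.
  by rewrite (hnorm_eq0 x0) /rdot linear0l [hnorm 0]/hnorm normr0 mul0r.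
have [y0|y0] := eqVneq (hnorm y) 0.
  by rewrite (hnorm_eq0 y0) rdotC /rdot linear0l [hnorm 0]/hnorm normr0 mulr0.
have : 0 < hnorm x * hnorm y by rewrite mulr_gt0 // lt0r ?x0 ?y0 hnorm_ge0.
(* Expanding this square gives 2 |x| |y| (|x| |y| - Re <x, y>) >= 0. *)
have := sqr_ge0 (hnorm ((hnorm y)%:C *: x - (hnorm x)%:C *: y)).
rewrite hnormB_sqr !hnormZ_sqr rdotZl rdotZr.
move: (hnorm x) (hnorm y) (rdot x y) => a b c; nra.
Qed.

Lemma rdot_inj x y : (forall z, rdot z x = rdot z y) -> x = y.
Proof.
move=> xy; apply/eqP; rewrite -subr_eq0; apply/eqP/hnorm_eq0/eqP.
by rewrite -sqrf_eq0 -rdotxx rdotBr xy subrr.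
Qed.

Lemma hdot_inj x y : (forall z, hdot z x = hdot z y) -> x = y.
Proof. by move=> xy; apply: rdot_inj => z; rewrite /rdot xy. Qed.

Lemma hnorm_cauchy (u : nat -> U) :
  (forall e, 0 < e -> exists N, forall n m, (N <= n)%N -> (N <= m)%N ->
    hnorm (u n - u m) < e) ->
  exists z, forall e, 0 < e -> exists N, forall n, (N <= n)%N ->
    hnorm (u n - z) < e.
Proof.
move=> cu.
have /cvg_ex[z uz] : cvg (u @ \oo).
  apply/cauchy_cvgP/cauchyP => e e0.
  (* The radius e lives in [R[i]]; being positive it is real, so its real part can replace it. *)
  have [|N uN] := cu (complex.Re e).
    by move: e0; rewrite ltcE => /andP[].
  exists (u N), N => // n /= Nn.
  rewrite -ball_normE /= -hnormK -(ge0_ReK (ltW e0)) ltcR.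
  exact: uN.
exists z => e e0.
have e0' : 0 < e%:C by rewrite ltcR.
have /cvgr_distC_lt/(_ e%:C e0')[N _ uN] := uz.
by exists N => n Nn; rewrite -ltcR hnormK; apply: uN.
Qed.

End real_inner_product.

(** * The Riesz representation theorem *)

Section riesz.
Variables (R : realType) (U : hilbertType R).

Lemma invn_lt_eventually (e : R) : 0 < e ->
  exists N, forall n, (N <= n)%N -> n.+1%:R^-1 < e.
Proof.
move=> e0; have ie0 : 0 <= e^-1 by rewrite invr_ge0 ltW.
exists (Num.bound e^-1) => n Nn.
rewrite invf_plt ?posrE ?ltr0n//; apply: lt_trans (archi_boundP ie0) _.
by rewrite ltr_nat ltnS.
Qed.

(* The representing vector minimises |x|^2 - 2 Re f x; by the parallelogram
   identity minimising sequences are Cauchy. *)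
Lemma riesz (f : {scalar U}) (c : R) :
  (forall x, complex.Re (f x) <= c * hnorm x) ->
  exists z, forall x, f x = hdot x z.
Proof.
move=> fc.
have fD x y : complex.Re (f (x + y)) = complex.Re (f x) + complex.Re (f y).
  by rewrite linearD ReD.
have fZ t x : complex.Re (f (t%:C *: x)) = t * complex.Re (f x).
  by rewrite linearZ /= ReZ.
pose phi x := hnorm x ^+ 2 - 2 * complex.Re (f x).
have phiD x y : phi (x + y) =
    phi x + (hnorm y ^+ 2 + 2 * rdot x y - 2 * complex.Re (f y)).
  by rewrite /phi hnormD_sqr fD; ring.
have lb : lbound (range phi) (- c ^+ 2).
  move=> _ [x _ <-]; rewrite /phi; have := fc x; have := sqr_ge0 (hnorm x - c).
  by move: (complex.Re _) (hnorm x) => a b; nra.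
pose m := inf (range phi).
have infphi : has_inf (range phi).
  by split; [exists (phi 0); exists 0|exists (- c ^+ 2)].
have phim x : m <= phi x by apply: ge_inf; [exists (- c ^+ 2)|exists x].
have /choice[u um] (n : nat) : exists x, phi x < m + n.+1%:R^-1.
  have [||_ [x _ <-] xm] := @inf_adherent _ (range phi) n.+1%:R^-1 => //.
  by exists x.
have u_cauchy n k :
    hnorm (u n - u k) ^+ 2 <= 2 * (n.+1%:R^-1 + k.+1%:R^-1).
  (* The value of phi at the midpoint is (phi (u n) + phi (u k)) / 2 - |u n - u k|^2 / 4, and it is
     at least m. *)
  have := phim ((2^-1)%:C *: (u n + u k)).
  have := um n; have := um k.
  rewrite /phi fZ fD hnormZ_sqr hnormD_sqr hnormB_sqr.
  move: (n.+1%:R^-1) (k.+1%:R^-1) (hnorm (u n) ^+ 2) (hnorm (u k) ^+ 2).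
  by move: (m) (rdot _ _) (complex.Re _) (complex.Re _) => *; lra.
have [|z uz] := hnorm_cauchy (u := u).
  move=> e e0; have [N Ne] := invn_lt_eventually (divr_gt0 (exprn_gt0 2 e0) (ltr0Sn R 3)).
  exists N => n k Nn Nk.
  rewrite -(ltr_pXn2r (n := 2)) ?nnegrE ?hnorm_ge0 ?ltW//.
  apply: le_lt_trans (u_cauchy n k) _.
  have := Ne _ Nn; have := Ne _ Nk.
  by move: (n.+1%:R^-1) (k.+1%:R^-1) (e ^+ 2) => p q s; lra.
have phiz : phi z <= m.
  apply/ler_addgt0Pr => e e0.
  (* With d = u n - z, phi z <= phi (u n) + 2 (|z| + |c|) |d|; once |d| < e / b the last term is at
     most e / 2. *)
  pose b := 4 * (hnorm z + `|c| + 1).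
  have b0 : 0 < b by have := hnorm_ge0 z; have := normr_ge0 c; rewrite /b; lra.
  have e20 : 0 < e / 2 by lra.
  have [N Ne] := invn_lt_eventually e20.
  have [M Me] := uz _ (divr_gt0 e0 b0).
  pose n := maxn N M.
  have := um n; have := Ne n (leq_maxl _ _); have := Me n (leq_maxr _ _).
  have := phiD z (u n - z); rewrite subrKC => ->.
  have := fc (u n - z); have := rdot_le (- z) (u n - z); rewrite rdotNl hnormN.
  have := ler_norm c; have := hnorm_ge0 (u n - z).
  rewrite ltr_pdivlMr // /b.
  move: (n.+1%:R^-1) (hnorm (_ - _)) (complex.Re _) (rdot _ _) => w d a r d0 cc.
  have := ler_wpM2r d0 cc; move: (hnorm z) (hnorm_ge0 z) (phi z) (m).
  move: `|c| (normr_ge0 c) => g g0 h h0 p q; nra.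
have reP x : complex.Re (f x) = rdot x z.
  (* Minimality of phi at z along the line z + t x. *)
  have q t : 0 <= t ^+ 2 * hnorm x ^+ 2 + 2 * t * (rdot x z - complex.Re (f x)).
    have := phim (z + t%:C *: x); rewrite phiD hnormZ_sqr fZ rdotZr (rdotC z).
    by move: phiz; lra.
  apply/eqP; rewrite eq_sym -subr_eq0; apply/eqP.
  move: (rdot x z - _) q => a q.
  (* At t = - s a the quadratic equals - s (1 + s) a^2, which forces a = 0. The summand 1 keeps s
     defined when x = 0. *)
  pose s := (1 + hnorm x ^+ 2)^-1.
  have h0 := sqr_ge0 (hnorm x).
  have s0 : 0 < s by rewrite invr_gt0; lra.
  have s1 : s * (1 + hnorm x ^+ 2) = 1 by rewrite mulVf //; lra.
  have := q (- s * a).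
  have -> : (- s * a) ^+ 2 * hnorm x ^+ 2 + 2 * (- s * a) * a =
     - (s * a ^+ 2 * (2 - s * hnorm x ^+ 2)) by ring.
  have -> : 2 - s * hnorm x ^+ 2 = 1 + s by rewrite -s1; ring.
  have sw : 0 < s * (1 + s) by rewrite mulr_gt0 //; lra.
  rewrite oppr_ge0 mulrAC (pmulr_rle0 _ sw) => a0.
  by apply/eqP; rewrite -sqrf_eq0 eq_le a0 sqr_ge0.
exists z => x; apply/eqP; rewrite eq_complex reP eqxx /=.
(* The real-part identity at i x is the imaginary-part identity at x. *)
have := reP ('i%C *: x); rewrite linearZ /= /rdot linearZl_LR /=.
by case: (f x) (hdot x z) => a b [a' b'] /=; rewrite !mul0r !mul1r !sub0r => /oppr_inj ->.
Qed.

End riesz.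

(** * Bounded maps and adjoint pairs *)

Definition bounded_by (R : realType) (U V : hilbertType R) (f : U -> V)
  (c : R) := forall x, hnorm (f x) <= c * hnorm x.

(** A relation, because [adjoint] falls back to 0 where no representing vector exists; this carries
    the actual duality. *)
Definition adjoint_pair (R : realType) (U V : hilbertType R) (f : U -> V)
  (g : V -> U) := forall x y, hdot (f x) y = hdot x (g y).

Lemma adjoint_pairC (R : realType) (U V : hilbertType R) (f : U -> V)
  (g : V -> U) : adjoint_pair f g -> adjoint_pair g f.
Proof. by move=> fg x y; rewrite hdotC -fg -hdotC. Qed.

Section adjoints.
Variables (R : realType) (U V : hilbertType R).
Implicit Types (f : U -> V) (g : V -> U) (c : R).

(** The inner product separates vectors, so [xget] can only select g y. *)
Lemma adjoint_eq f g : adjoint_pair f g -> adjoint f = g.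
Proof.
move=> fg; apply/funext => y; rewrite /adjoint; case: xgetP => [z _ /= fz|/(_ (g y))[]//].
by apply: hdot_inj => x; rewrite -fz fg.
Qed.

(** Riesz applied to x |-> <f x, y>, a functional bounded by c |y|. *)
Lemma adjointP f c : linear f -> bounded_by f c -> adjoint_pair f (adjoint f).
Proof.
move=> lf fc x y; rewrite /adjoint; case: xgetP => [z _ /= //|].
have ls : scalar (fun x => hdot (f x) y).
  by move=> a u v; rewrite lf linearPl.
pose h : {scalar U} := HB.pack (fun x => hdot (f x) y)
  (GRing.isLinear.Build _ _ _ _ (fun x => hdot (f x) y) ls).
have [|z hz] := @riesz _ _ h (c * hnorm y); last by move=> /(_ z)[].
move=> u /=; apply: le_trans (rdot_le (f u) y) _.
by rewrite mulrAC ler_wpM2r // hnorm_ge0.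
Qed.

Lemma rdot_adjoint f g : adjoint_pair f g ->
  forall x y, rdot (f x) y = rdot x (g y).
Proof. by move=> fg x y; rewrite /rdot fg. Qed.

Lemma adjoint_pair_linear f g : adjoint_pair f g -> linear g.
Proof.
move=> fg a y z; apply: hdot_inj => x.
by rewrite -fg !linearDr !linearZr_LR /= !fg.
Qed.

(** |g y|^2 = Re <f (g y), y> <= c |g y| |y|; divide by |g y|. *)
Lemma adjoint_pair_bounded f g c : 0 <= c ->
  adjoint_pair f g -> bounded_by f c -> bounded_by g c.
Proof.
move=> c0 fg fc y.
have := rdot_le (f (g y)) y; rewrite (rdot_adjoint fg) rdotxx.
have [->|g0] := eqVneq (hnorm (g y)) 0; first by rewrite mulr_ge0 ?hnorm_ge0.
have {g0} : 0 < hnorm (g y) by rewrite lt0r g0 hnorm_ge0.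
have := ler_wpM2r (hnorm_ge0 y) (fc (g y)).
move: (hnorm (f _)) (hnorm (g y)) (hnorm y) => p q r h q0 h'.
by rewrite -(ler_pM2r q0) -expr2 (le_trans h')// mulrAC.
Qed.

End adjoints.

(** * The operator norm and pointwise bounds *)

Section operator_norm.
Variables (R : realType) (U V : hilbertType R).
Implicit Types (f : U -> V) (c : R).

Lemma opnorm_ge f x : `|x| <= 1 -> ((hnorm (f x))%:E <= opnorm f)%E.
Proof. by move=> x1; apply: ereal_sup_ubound; exists x. Qed.

Lemma opnorm_ge0 f : (0 <= opnorm f)%E.
Proof.
apply: le_trans (opnorm_ge f (x := 0) _); last by rewrite normr0.
by rewrite lee_fin hnorm_ge0.
Qed.

(** By homogeneity, the bound on the unit ball at x / |x| extends to every nonzero x. *)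
Lemma opnorm_bounded_by f c : linear f ->
  (opnorm f <= c%:E)%E -> bounded_by f c.
Proof.
move=> lf fc x.
have fZ a y : f (a *: y) = a *: f y.
  have f0 : f 0 = 0.
    by apply: (addrI (f 0)); rewrite addr0 -{3}[0]addr0 -[X in f (X + _)]scale1r lf scale1r.
  by have := lf a y 0; rewrite f0 !addr0.
have [x0|x0] := eqVneq (hnorm x) 0.
  by rewrite x0 (hnorm_eq0 x0) -(scale0r 0) fZ scale0r /hnorm normr0 mulr0.
have hx : 0 < hnorm x by rewrite lt0r x0 hnorm_ge0.
have xE : x = (hnorm x)%:C *: ((hnorm x)^-1%:C *: x).
  by rewrite scalerA -rmorphM /= mulfV // scale1r.
have Zn t (W : hilbertType R) (w : W) : 0 < t -> hnorm (t%:C *: w) = t * hnorm w.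
  by move=> t0; rewrite hnormZ ger0_norm // ltW // ltcR.
rewrite {1}xE fZ Zn // mulrC ler_wpM2r ?hnorm_ge0 //.
rewrite -lee_fin; apply: le_trans fc; apply: opnorm_ge.
by rewrite -hnormK Zn ?invr_gt0 // mulVf.
Qed.

Lemma bounded_by_opnorm f c : 0 <= c -> bounded_by f c -> (opnorm f <= c%:E)%E.
Proof.
move=> c0 fc; apply: ge_ereal_sup => _ [x /= x1 <-]; rewrite lee_fin.
apply: le_trans (fc x) _; rewrite -[leRHS]mulr1 ler_wpM2l //.
by rewrite -lecR hnormK.
Qed.

End operator_norm.

(** * Isometries into a common space *)

Section isometries.
Variables (R : realType) (U V W : hilbertType R).
Variables (i : {linear U -> W}) (j : {linear V -> W}).
Variables (i' : W -> U) (j' : W -> V).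
Hypotheses (i_iso : is_isometry i) (j_iso : is_isometry j).
Hypotheses (ii' : adjoint_pair i i') (jj' : adjoint_pair j j').

Lemma isometry_hnorm x : hnorm (i x) = hnorm x.
Proof. by rewrite /hnorm i_iso. Qed.

Lemma isometry_adjoint_hnorm y : hnorm (i' y) <= hnorm y.
Proof.
rewrite -[leRHS]mul1r; apply: (adjoint_pair_bounded _ ii') => // x.
by rewrite isometry_hnorm mul1r.
Qed.

(* With J = j' i, the left-hand side is |u|^2 - |J u|^2 = Re <(1 - J' J) u, u>. *)
Lemma isometry_defect u :
  hnorm (i u - j (j' (i u))) ^+ 2 <= hnorm (u - i' (j (j' (i u)))) * hnorm u.
Proof.
have jN v : hnorm (j v) = hnorm v by rewrite /hnorm j_iso.
apply: le_trans (rdot_le _ _).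
rewrite rdotBl (rdot_adjoint (adjoint_pairC ii')) rdotxx.
rewrite hnormB_sqr jN isometry_hnorm (rdotC (j _)).
rewrite -(rdot_adjoint (adjoint_pairC jj')) rdotxx; lra.
Qed.

End isometries.

(** * The three-term estimate, with J = j' i and J' = i' j *)

Section resolvent_difference.
Variables (R : realType) (U V W : hilbertType R).
Variables (i : {linear U -> W}) (j : {linear V -> W}).
Variables (i' : W -> U) (j' : W -> V).
Hypotheses (i_iso : is_isometry i) (j_iso : is_isometry j).
Hypotheses (ii' : adjoint_pair i i') (jj' : adjoint_pair j j').
Variables (S : U -> U) (T T' : V -> V) (d t : R).
Hypotheses (d_ge0 : 0 <= d) (t_ge0 : 0 <= t).
Hypotheses (T_lin : linear T) (T_bdd : bounded_by T t) (TT' : adjoint_pair T T').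
Hypothesis S_defect : bounded_by (fun x => S x - i' (j (j' (i (S x))))) d.
Hypothesis T'_defect : bounded_by (fun x => T' x - j' (i (i' (j (T' x))))) d.
Hypothesis ST_defect : bounded_by (fun x => T (j' (i x)) - j' (i (S x))) d.

Let iN := isometry_hnorm i_iso.
Let jN := isometry_hnorm j_iso.
Let i'N := isometry_adjoint_hnorm i_iso ii'.
Let j'N := isometry_adjoint_hnorm j_iso jj'.

(** Controls S by t and d alone, so that the final speed involves only the norm of the limit
    resolvent. *)
Lemma compression_bounded : bounded_by S (t + 2 * d).
Proof.
move=> x.
have -> : S x = (S x - i' (j (j' (i (S x))))) + i' (j (j' (i (S x)))).
  by rewrite subrK.
apply: le_trans (ler_hnormD _ _) _.
have := S_defect x; have := i'N (j (j' (i (S x)))); rewrite jN.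
have : hnorm (j' (i (S x))) <= (t + d) * hnorm x.
  rewrite -[j' _](subrK (T (j' (i x)))) -opprB.
  apply: le_trans (ler_hnormD _ _) _; rewrite hnormN.
  have := ST_defect x; have := T_bdd (j' (i x)).
  have := ler_wpM2l t_ge0 (j'N (i x)); rewrite iN; lra.
lra.
Qed.

(** [isometry_defect] at u = S x: the squared norm is at most d |x| times (t + 2 d) |x|. *)
Lemma range_defect x :
  hnorm (i (S x) - j (j' (i (S x)))) <= Num.sqrt (d * (t + 2 * d)) * hnorm x.
Proof.
have r0 : 0 <= t + 2 * d by rewrite addr_ge0 ?mulr_ge0.
rewrite -(ler_pXn2r (n := 2)) ?nnegrE ?mulr_ge0 ?hnorm_ge0 ?sqrtr_ge0 //.
rewrite exprMn sqr_sqrtr ?mulr_ge0 //.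
apply: le_trans (isometry_defect i_iso j_iso ii' jj' (S x)) _.
have := ler_pM (hnorm_ge0 _) (hnorm_ge0 _) (S_defect x) (compression_bounded x).
by rewrite mulrACA -expr2.
Qed.

(** By duality this is the range defect of T' with i and j exchanged. T' inherits the bound t from
    T, whence d t under the root. *)
Lemma corange_defect y :
  hnorm (T (j' (y - i (i' y)))) <= Num.sqrt (d * t) * hnorm y.
Proof.
set v := T _.
have T'_bdd : bounded_by T' t by apply: (adjoint_pair_bounded t_ge0 TT').
have h : hnorm (j (T' v) - i (i' (j (T' v)))) <= Num.sqrt (d * t) * hnorm v.
  rewrite -(ler_pXn2r (n := 2)) ?nnegrE ?mulr_ge0 ?hnorm_ge0 ?sqrtr_ge0 //.
  rewrite exprMn sqr_sqrtr ?mulr_ge0 //.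
  apply: le_trans (isometry_defect j_iso i_iso jj' ii' (T' v)) _.
  have := ler_pM (hnorm_ge0 _) (hnorm_ge0 _) (T'_defect v) (T'_bdd v).
  by rewrite mulrACA -expr2.
(* |v|^2 = Re <y, (1 - i i') j T' v>, moving T, j' and the symmetric map 1 - i i' across the inner
   product. *)
have : hnorm v ^+ 2 <= hnorm y * hnorm (j (T' v) - i (i' (j (T' v)))).
  apply: le_trans (rdot_le _ _).
  rewrite -rdotxx {1}/v (rdot_adjoint TT') (rdot_adjoint (adjoint_pairC jj')).
  rewrite rdotBl rdotBr (rdot_adjoint ii') -(rdot_adjoint (adjoint_pairC ii')).
  by [].
have := ler_wpM2l (hnorm_ge0 y) h.
have [->|v0] := eqVneq (hnorm v) 0; first by rewrite mulr_ge0 ?hnorm_ge0 ?sqrtr_ge0.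
have {}v0 : 0 < hnorm v by rewrite lt0r v0 hnorm_ge0.
move=> h1 h2; rewrite -(ler_pM2r v0) -expr2; apply: le_trans h2 _.
by apply: le_trans h1 _; rewrite mulrCA mulrA.
Qed.

Lemma compression_difference :
  bounded_by (fun y => i (S (i' y)) - j (T (j' y)))
    (Num.sqrt d * (2 * Num.sqrt (t + 2 * d) + Num.sqrt d)).
Proof.
move=> y; set s := i' y.
have j'_lin := adjoint_pair_linear jj'.
have j'B a b : j' (a - b) = j' a - j' b.
  by rewrite -[- b]scaleN1r addrC j'_lin scaleN1r addrC.
have TB a b : T (a - b) = T a - T b.
  by rewrite -[- b]scaleN1r addrC T_lin scaleN1r addrC.
have -> : i (S s) - j (T (j' y)) = (i (S s) - j (j' (i (S s))))
    - j (T (j' (i s)) - j' (i (S s))) - j (T (j' (y - i s))).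
  rewrite j'B TB (raddfB j) (raddfB j) /=.
  by rewrite !opprB !addrA !subrK.
apply: le_trans (ler_hnormD _ _) _; rewrite hnormN jN.
apply: le_trans (lerD (ler_hnormD _ _) (lexx _)) _; rewrite hnormN jN.
have := range_defect s; have := corange_defect y; rewrite -/s.
have := ST_defect s.
have sy : hnorm s <= hnorm y by apply: i'N.
have := ler_wpM2l d_ge0 sy.
have := ler_wpM2l (sqrtr_ge0 (d * (t + 2 * d))) sy.
(* Enlarging t to t + 2 d gives both outer terms the same bound, hence the factor 2 in the speed. *)
have : Num.sqrt (d * t) * hnorm y <= Num.sqrt (d * (t + 2 * d)) * hnorm y.
  by rewrite ler_wpM2r ?hnorm_ge0 // ler_wsqrtr // ler_wpM2l // lerDl mulr_ge0.
have -> : Num.sqrt d * (2 * Num.sqrt (t + 2 * d) + Num.sqrt d) * hnorm y =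
    2 * (Num.sqrt (d * (t + 2 * d)) * hnorm y) + d * hnorm y.
  by rewrite sqrtrM // -[X in _ = _ + X * _](sqr_sqrtr d_ge0); ring.
lra.
Qed.

End resolvent_difference.

(** * Resolvents of unbounded operators *)

Section resolvents.
Variables (R : realType) (H : hilbertType R) (A : unbounded_operator H).
Variables (z : R[i]) (zA : resolvent_set A z).

(** Surjectivity of A - z rules out the default value of [xget]. *)
Lemma resolventP y :
  op_dom A (resolvent A z y) /\ A (resolvent A z y) - z *: resolvent A z y = y.
Proof.
rewrite /resolvent; case: xgetP => [x _ //|].
have [[_ _ sA] _] := zA; have [x Dx <-] := sA y I.
by move=> /(_ x)[].
Qed.

Lemma resolvent_eq x y :
  op_dom A x -> A x - z *: x = y -> resolvent A z y = x.
Proof.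
move=> Dx xy; have [Dr ry] := resolventP y.
have [[_ iA _] _] := zA.
by apply: iA; rewrite ?inE // ry xy.
Qed.

Lemma resolvent_linear : linear (resolvent A z).
Proof.
move=> a x y; have [Dx xE] := resolventP x; have [Dy yE] := resolventP y.
apply: resolvent_eq; first exact: op_dom_linear.
rewrite op_fun_linear // -[in RHS]xE -[in RHS]yE scalerDr scalerBr !scalerA mulrC.
by rewrite opprD addrACA.
Qed.

Lemma resolvent_bounded :
  bounded_by (resolvent A z) (fine (opnorm (resolvent A z))).
Proof.
apply: opnorm_bounded_by; first exact: resolvent_linear.
by rewrite fineK // ge0_fin_numE ?opnorm_ge0 //; have [] := zA.
Qed.

(** Write x = (A - z) u and y = (A - z) v; self-adjointness moves A across <u, v>, and a real z
    equals its conjugate. *)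
Lemma resolvent_symmetric : self_adjoint A -> z \is Num.real ->
  adjoint_pair (resolvent A z) (resolvent A z).
Proof.
move=> [_ sA] zR x y.
have [Dx xE] := resolventP x; have [Dy yE] := resolventP y.
rewrite -{2}xE -{1}yE.
move: (resolvent A z x) (resolvent A z y) Dx Dy {xE yE} => u v Du Dv.
have /(_ u Du)/= uv : adjoint_graph A (v, A v) by rewrite sA.
by rewrite linearBr linearBl linearZr_LR linearZl_LR /= uv conj_Creal.
Qed.

End resolvents.

(** * From the QUE bounds to Weidmann convergence *)

Lemma linear_comp (R : realType) (U V W : hilbertType R)
    (f : U -> V) (g : V -> W) : linear f -> linear g -> linear (g \o f).
Proof. by move=> lf lg a x y; rewrite /= lf lg. Qed.

Lemma linear_sub (R : realType) (U V : hilbertType R)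
    (f g : U -> V) : linear f -> linear g -> linear (f \- g).
Proof.
by move=> lf lg a x y; rewrite /= lf lg opprD addrACA scalerBr.
Qed.

(** The estimate for one index n, obtained by feeding the QUE bounds to [compression_difference]. *)
Lemma factorised_weidmann_bound (R : realType) (U V W : hilbertType R)
    (A : unbounded_operator U) (B : unbounded_operator V) (z : R[i])
    (i : {linear U -> W}) (j : {linear V -> W}) (J : {linear U -> V}) (d : R) :
  is_isometry i -> is_isometry j -> J = adjoint j \o i :> (U -> V) ->
  0 <= d -> resolvent_set A z -> resolvent_set B z -> self_adjoint B ->
  que_bounds J (resolvent A z) (resolvent B z) d ->
  (z \isn't Num.real ->
    que_bounds J (adjoint (resolvent A z)) (adjoint (resolvent B z)) d) ->
  (opnorm ((i \o resolvent A z \o adjoint i) \- (j \o resolvent B z \o adjoint j))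
    <= (Num.sqrt d * (2 * Num.sqrt (fine (opnorm (resolvent B z)) + 2 * d)
        + Num.sqrt d))%:E)%E.
Proof.
move=> i_iso j_iso JE d0 zA zB saB que que'.
have adjI (X : hilbertType R) (f : {linear X -> W}) :
    is_isometry f -> adjoint_pair f (adjoint f).
  move=> f_iso; apply: (@adjointP _ _ _ f 1); first exact: linearP.
  by move=> x; rewrite mul1r isometry_hnorm.
have ii' := adjI _ i i_iso; have jj' := adjI _ j j_iso.
have J'E : adjoint J = adjoint i \o j.
  apply: adjoint_eq => x y; rewrite JE /= -(ii' x (j y)).
  by rewrite (adjoint_pairC jj').
have lS := resolvent_linear zA; have lT := resolvent_linear zB.
have TT' := adjointP lT (resolvent_bounded zB).
have lT' := adjoint_pair_linear TT'.
have li := adjoint_pair_linear ii'; have lj := adjoint_pair_linear jj'.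
(* For real z the adjoint resolvent is the resolvent itself; otherwise the bound is among the extra
   QUE conditions on adjoints. *)
have T'q : (opnorm ((idfun \- (J \o adjoint J))%R \o adjoint (resolvent B z))
    <= d%:E)%E.
  have [zR|zR] := boolP (z \is Num.real); last by have [] := que' zR.
  by rewrite (adjoint_eq (resolvent_symmetric zB saB zR)); have [] := que.
have [q1 _ q3] := que.
have t0 : 0 <= fine (opnorm (resolvent B z)) by rewrite fine_ge0 ?opnorm_ge0.
apply: bounded_by_opnorm.
  by rewrite mulr_ge0 ?sqrtr_ge0 // addr_ge0 ?mulr_ge0 ?sqrtr_ge0.
apply: (compression_difference i_iso j_iso ii' jj' d0 t0 lT
  (resolvent_bounded zB) TT').
- move: q1; rewrite J'E JE => /opnorm_bounded_by; apply.
  apply: linear_comp => //; apply: linear_sub => //.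
  by do 3?[apply: linear_comp] => //; apply: linearP.
- move: T'q; rewrite J'E JE => /opnorm_bounded_by; apply.
  apply: linear_comp => //; apply: linear_sub => //.
  by do 3?[apply: linear_comp] => //; apply: linearP.
- move: q3; rewrite JE => /opnorm_bounded_by; apply.
  by apply: linear_sub; do 3?[apply: linear_comp] => //; apply: linearP.
Qed.

Theorem theorem2p10 (R : realType) (H : nat -> hilbertType R)
    (Hoo : hilbertType R) (A : forall n, unbounded_operator (H n))
    (Aoo : unbounded_operator Hoo) (z0 : R[i])
    (J : forall n, {linear H n -> Hoo}) (delta : R^nat) :
  (forall n, self_adjoint (A n)) ->
  self_adjoint Aoo ->
  que_converges A Aoo z0 J delta ->
  (exists P : parent_space H Hoo, factorises P J) ->
  let delta' : R^nat := fun n =>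
    Num.sqrt (delta n) *
    (2 * Num.sqrt (fine (opnorm (resolvent Aoo z0)) + 2 * delta n)
     + Num.sqrt (delta n)) in
  weidmann_converges A Aoo z0 delta' /\
  delta' =O_\oo (fun n => Num.sqrt (delta n)).
Proof.
move=> saA saAoo [[d0 dcvg] zA zAoo que] [P fP] delta'.
set t := fine _ in delta' *.
have t0 : 0 <= t by rewrite fine_ge0 ?opnorm_ge0.
(* The cofactor of [Num.sqrt (delta n)] in [delta']; its convergence yields both the O-bound and the
   limit 0. *)
pose k n := 2 * Num.sqrt (t + 2 * delta n) + Num.sqrt (delta n).
have kcvg : k n @[n --> \oo] --> 2 * Num.sqrt (t + 2 * 0) + Num.sqrt 0.
  apply: cvgD; last exact: (continuous_cvg _ (@sqrt_continuous R 0)).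
  apply: cvgMl_tmp; apply: (continuous_cvg _ (@sqrt_continuous R _)).
  by apply: cvgD; [exact: cvg_cst|exact: cvgMl_tmp].
have k0 n : 0 <= k n by rewrite addr_ge0 ?mulr_ge0 ?sqrtr_ge0.
split; last first.
  apply/eqO_exP.
  set l := 2 * _ + _ in kcvg.
  have l0 : 0 <= l by rewrite addr_ge0 ?mulr_ge0 ?sqrtr_ge0.
  exists (l + 1); first by rewrite ltr_wpDl.
  have /cvgr_le/(_ (l + 1)) := kcvg; rewrite ltrDl ltr01 => /(_ isT).
  apply: filterS => n /= kn.
  by rewrite normrM mulrC ler_wpM2r // ger0_norm.
split => //.
- split; first by move=> n; rewrite mulr_ge0 ?sqrtr_ge0 // k0.
  rewrite -[0](mul0r (2 * Num.sqrt (t + 2 * 0) + Num.sqrt 0)) -{1}sqrtr0.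
  by apply: cvgM => //; apply: (continuous_cvg _ (@sqrt_continuous R 0)).
(* The parent space that factorises J itself witnesses Weidmann convergence. *)
- exists P => n; have [_ _ q q'] := que n.
  exact: (factorised_weidmann_bound (@ps_iota_isometry _ _ _ P n)
    (@ps_iotaoo_isometry _ _ _ P) (fP n) (d0 n) (zA n) zAoo saAoo q q').
Qed.
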